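(* Let $\gamma(s)=(x(s),y(s))$ be a conformal soliton of the inverse curve shortening flow in $\mathbb{H}^2$, i.e. the first two components of the maximal solution $(x(s),y(s),\theta(s))$ of $$x'=\cos\theta,\qquad y'=\sin\theta,\qquad \theta'=-\frac{1}{\cos\theta}-\frac{\cos\theta}{y}$$ with initial conditions $(x(0),y(0),\theta(0))=(0,y_0,0)$, $y_0>0$. Then $\gamma$ is a concave graph on the $x$-axis over some bounded interval $(x_m,x_M)$, where the limits of the tangents at the endpoints are vertical.
   Context: $\mathbb{H}^2$ is the upper half-plane $\{(x,y)\in\mathbb{R}^2: y>0\}$ with metric $(dx^2+dy^2)/y^2$. For a regular curve $\gamma=(x,y)$, the unit normal is $N=y\,(-y',x')/\sqrt{x'^2+y'^2}$ and the hyperbolic curvature is $\kappa=y\kappa_e+x'/\sqrt{x'^2+y'^2}$, where $\kappa_e=(x'y''-x''y')/(x'^2+y'^2)^{3/2}$. A conformal soliton of the inverse curve shortening flow is a curve satisfying $1/\kappa=-\langle N,\partial_y\rangle$; when $\gamma$ is parametrized by Euclidean arc length with $x'=\cos\theta$, $y'=\sin\theta$, this is equivalent to the displayed system (for which $\cos\theta\neq0$, so that here $\theta\in(-\pi/2,\pi/2)$). A graph on the $x$-axis is a curve of the form $y=y(x)$. *)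

(* Defs.v *)
From Stdlib Require Import Reals.
From Coquelicot Require Import Coquelicot.
Open Scope R_scope.

Definition Rbar_interval (a b : Rbar) (s : R) : Prop :=
  Rbar_lt a s /\ Rbar_lt s b.

(** The vector field is defined on the open set where [0 < y] (upper
    half-plane) and [cos theta <> 0], so a solution must stay in that set.
    Only the values of [x], [y], [theta] on [(a, b)] matter. *)
Definition is_solution (a b : Rbar) (x y theta : R -> R) : Prop :=
  forall s : R, Rbar_interval a b s ->
    0 < y s /\ cos (theta s) <> 0 /\
    is_derive x s (cos (theta s)) /\
    is_derive y s (sin (theta s)) /\
    is_derive theta s (- (1 / cos (theta s)) - cos (theta s) / y s).

Definition is_maximal_solution (a b : Rbar) (x y theta : R -> R) : Prop :=
  is_solution a b x y theta /\
  forall (a' b' : Rbar) (x' y' theta' : R -> R),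
    Rbar_le a' a -> Rbar_le b b' ->
    is_solution a' b' x' y' theta' ->
    (forall s : R, Rbar_interval a b s ->
       x' s = x s /\ y' s = y s /\ theta' s = theta s) ->
    a' = a /\ b' = b.

(** The trace of [s |-> (x s, y s)], [s] in [(a, b)], is the graph of [f]
    over [(xm, xM)]. *)
Definition is_graph_over (a b : Rbar) (x y : R -> R) (xm xM : R)
    (f : R -> R) : Prop :=
  forall p q : R,
    (exists s : R, Rbar_interval a b s /\ x s = p /\ y s = q) <->
    (xm < p < xM /\ q = f p).

Definition concave_on (xm xM : R) (f : R -> R) : Prop :=
  forall p q t : R, xm < p < xM -> xm < q < xM -> 0 <= t <= 1 ->
    t * f p + (1 - t) * f q <= f (t * p + (1 - t) * q).

(** Along the filter [F] of parameters, the curve approaches the line of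
    abscissa [xe] and its velocity [(x', y')] converges to a nonzero vertical
    vector; for a curve parametrized by arc length the velocity is the unit
    tangent. *)
Definition vertical_tangent_limit (F : (R -> Prop) -> Prop) (x y : R -> R)
    (xe : R) : Prop :=
  filterlim x F (locally xe) /\
  exists v : R, v <> 0 /\
    filterlim (Derive x) F (locally 0) /\
    filterlim (Derive y) F (locally v).

(* Main.v *)
Require Import Defs.
From Stdlib Require Import Reals Lra ClassicalEpsilon.
From Coquelicot Require Import Coquelicot.
Open Scope R_scope.

(** The quantity [C = (cos^2 theta + 2 y) / y^2] is constant along solutions,
    and on each of its level sets the system gives the linear equation
    [y'' = cos theta theta' = - 1 - cos^2 theta / y = 1 - C y].  With
    [C = omega^2 = (1 + 2 y0) / y0^2] this yields
    [y = (y0^2 + y0 (1 + y0) cos (omega s)) / (1 + 2 y0)] and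
    [sin theta = - K sin (omega s)] with [K = (1 + y0) / sqrt (1 + 2 y0) > 1].
    These formulas define a solution exactly up to the parameters [+/- B] at
    which [K sin (omega B) = 1], so the maximal interval is [(-B, B)], and at
    its ends [cos theta] tends to [0].  The graph is concave because its slope
    [tan theta] decreases. *)

(** * Calculus on open intervals with possibly infinite ends *)

Lemma Rbar_interval_between (a b : Rbar) (s t u : R) :
  Rbar_interval a b s -> Rbar_interval a b t ->
  Rmin s t <= u <= Rmax s t -> Rbar_interval a b u.
Proof.
  unfold Rmin, Rmax, Rbar_interval.
  destruct a as [a| |], b as [b| |]; simpl; destruct (Rle_dec s t);
    intuition lra.
Qed.

Lemma is_derive_continuity_pt (f : R -> R) (s l : R) :
  is_derive f s l -> continuity_pt f s.
Proof.
  intros H. apply derivable_continuous_pt. exists l. now apply is_derive_Reals.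
Qed.

Lemma mean_value_Rbar_interval (a b : Rbar) (f df : R -> R) (s t : R) :
  (forall u, Rbar_interval a b u -> is_derive f u (df u)) ->
  Rbar_interval a b s -> Rbar_interval a b t ->
  exists c, Rbar_interval a b c /\ Rmin s t <= c <= Rmax s t /\
    f t - f s = df c * (t - s).
Proof.
  intros Hf Hs Ht.
  destruct (MVT_gen f s t df) as [c [Hc E]].
  - intros u Hu. apply Hf, (Rbar_interval_between a b s t); auto; lra.
  - intros u Hu. apply (is_derive_continuity_pt f u (df u)), Hf,
      (Rbar_interval_between a b s t); auto.
  - exists c. split; [apply (Rbar_interval_between a b s t)|]; auto.
Qed.

Lemma null_derivative_Rbar_interval (a b : Rbar) (f : R -> R) (s t : R) :
  (forall u, Rbar_interval a b u -> is_derive f u 0) ->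
  Rbar_interval a b s -> Rbar_interval a b t -> f t = f s.
Proof.
  intros Hf Hs Ht.
  destruct (mean_value_Rbar_interval a b f (fun _ => 0) s t Hf Hs Ht)
    as [c [_ [_ E]]]. lra.
Qed.

Lemma increasing_Rbar_interval (a b : Rbar) (f df : R -> R) (s t : R) :
  (forall u, Rbar_interval a b u -> is_derive f u (df u) /\ 0 < df u) ->
  Rbar_interval a b s -> Rbar_interval a b t -> s < t -> f s < f t.
Proof.
  intros Hf Hs Ht Hst.
  destruct (mean_value_Rbar_interval a b f df s t) as [c [Hc [_ E]]]; auto.
  - intros u Hu. now apply Hf.
  - assert (0 < df c) by now apply Hf. nra.
Qed.

Lemma positive_of_nonzero_Rbar_interval (a b : Rbar) (f : R -> R) (s t : R) :
  (forall u, Rbar_interval a b u -> continuity_pt f u /\ f u <> 0) ->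
  Rbar_interval a b s -> Rbar_interval a b t -> 0 < f s -> 0 < f t.
Proof.
  intros Hf Hs Ht H0.
  destruct (Rlt_le_dec 0 (f t)) as [|Hle]; auto. exfalso.
  assert (Hft : f t < 0) by (destruct (Hf t Ht); lra).
  destruct (Rtotal_order s t) as [Hst|[Hst|Hst]].
  - destruct (Ranalysis5.IVT_interv (fun u => - f u) s t) as [z [Hz E]]; try lra.
    + intros u Hu. apply continuity_pt_opp, Hf, (Rbar_interval_between a b s t); auto.
      rewrite Rmin_left, Rmax_right; lra.
    + destruct (Hf z); try lra.
      apply (Rbar_interval_between a b s t); auto.
      rewrite Rmin_left, Rmax_right; lra.
  - subst; lra.
  - destruct (Ranalysis5.IVT_interv f t s) as [z [Hz E]]; try lra.
    + intros u Hu. apply Hf, (Rbar_interval_between a b t s); auto.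
      rewrite Rmin_left, Rmax_right; lra.
    + destruct (Hf z); try lra.
      apply (Rbar_interval_between a b t s); auto.
      rewrite Rmin_left, Rmax_right; lra.
Qed.

(** The curve is known only inside its open interval of parameters. Its limits at an end are read
    off a formula [g] that agrees with it there and is continuous at the end itself. *)
Lemma filterlim_within_continuous (D : R -> Prop) (f g : R -> R) (e : R) :
  (forall s, D s -> g s = f s) -> continuous g e ->
  filterlim f (within D (Rbar_locally e)) (locally (g e)).
Proof.
  intros E Hg. apply (filterlim_within_ext D g f); auto.
  apply (filterlim_filter_le_1 _ (filter_le_within D)), Hg.
Qed.

Lemma is_derive_asin (z : R) :
  -1 < z < 1 -> is_derive asin z (/ sqrt (1 - z * z)).
Proof.
  intros Hz. apply is_derive_Reals.
  pose proof (derive_pt_eq_1 _ _ _ _ (derive_pt_asin z Hz)) as H.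
  unfold Rdiv, Rsqr in H. now rewrite Rmult_1_l in H.
Qed.

(** * The explicit solution *)

Definition root (y0 : R) : R := sqrt (1 + 2 * y0).
Definition omega (y0 : R) : R := root y0 / y0.
(** The constant K of the overview. *)
Definition ampl (y0 : R) : R := (1 + y0) / root y0.
(** The parameter B of the overview: the first positive [s] at which [neg_sin y0 s] equals 1. *)
Definition half_width (y0 : R) : R := asin (/ ampl y0) / omega y0.
Definition neg_sin (y0 s : R) : R := ampl y0 * sin (omega y0 * s).
(* Rocq's [sqrt] vanishes on negative numbers, so that [sol_cos] and its
   primitive [sol_x] are continuous on the whole line, past the endpoints
   [+/- half_width] of the solution. *)
Definition sol_cos (y0 s : R) : R := sqrt (1 - neg_sin y0 s * neg_sin y0 s).
Definition sol_x (y0 s : R) : R := RInt (sol_cos y0) 0 s.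
Definition sol_y (y0 s : R) : R :=
  (y0 * y0 + y0 * (1 + y0) * cos (omega y0 * s)) / (1 + 2 * y0).
Definition sol_theta (y0 s : R) : R := - asin (neg_sin y0 s).

Section ExplicitSolution.

Context (y0 : R) (hy0 : 0 < y0).

Lemma root_pos : 0 < root y0.
Proof. apply sqrt_lt_R0. lra. Qed.

Lemma root_sqr : root y0 * root y0 = 1 + 2 * y0.
Proof. apply sqrt_sqrt. lra. Qed.

Lemma omega_pos : 0 < omega y0.
Proof. apply Rdiv_lt_0_compat; auto using root_pos. Qed.

(** The square of [1 + y0] exceeds that of [root y0] by [y0 * y0]. Strictness puts
    [asin (/ ampl y0)] below [PI / 2], so the solution breaks down within a quarter period of the
    oscillation. *)
Lemma ampl_gt1 : 1 < ampl y0.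
Proof.
  pose proof root_pos. pose proof root_sqr. unfold ampl.
  apply (Rmult_lt_reg_r (root y0)); auto.
  replace ((1 + y0) / root y0 * root y0) with (1 + y0) by (field; lra). nra.
Qed.

Lemma inv_ampl_bounds : 0 < / ampl y0 < 1.
Proof.
  pose proof ampl_gt1. split.
  - apply Rinv_0_lt_compat. lra.
  - rewrite <- Rinv_1. apply Rinv_lt_contravar; lra.
Qed.

Lemma omega_half_width :
  omega y0 * half_width y0 = asin (/ ampl y0).
Proof. pose proof omega_pos. unfold half_width. field. lra. Qed.

Lemma asin_inv_ampl_bounds : 0 < asin (/ ampl y0) < PI / 2.
Proof.
  pose proof inv_ampl_bounds. split; [|apply asin_bound_lt; lra].
  destruct (Rle_lt_dec (asin (/ ampl y0)) 0) as [Hle|]; auto.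
  pose proof (asin_bound (/ ampl y0)).
  assert (E : sin (asin (/ ampl y0)) <= sin 0)
    by (apply sin_incr_1; pose proof PI_RGT_0; lra).
  rewrite sin_asin, sin_0 in E; lra.
Qed.

Lemma half_width_pos : 0 < half_width y0.
Proof.
  apply Rdiv_lt_0_compat; auto using omega_pos. apply asin_inv_ampl_bounds.
Qed.

Lemma neg_sin_half_width : neg_sin y0 (half_width y0) = 1.
Proof.
  pose proof inv_ampl_bounds. pose proof ampl_gt1.
  unfold neg_sin. rewrite omega_half_width, sin_asin by lra. field. lra.
Qed.

Lemma neg_sin_opp (s : R) : neg_sin y0 (- s) = - neg_sin y0 s.
Proof.
  unfold neg_sin. replace (omega y0 * - s) with (- (omega y0 * s)) by ring.
  rewrite sin_neg. ring.
Qed.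

Lemma omega_mul_bounds (s : R) :
  - half_width y0 < s < half_width y0 ->
  - asin (/ ampl y0) < omega y0 * s < asin (/ ampl y0).
Proof.
  intros Hs. rewrite <- omega_half_width. pose proof omega_pos. nra.
Qed.

(** On this range [omega y0 * s] stays where the sine is strictly increasing, and [neg_sin] takes
    the values -1 and 1 at the two ends. *)
Lemma neg_sin_bounds (s : R) :
  - half_width y0 < s < half_width y0 -> -1 < neg_sin y0 s < 1.
Proof.
  intros Hs. apply omega_mul_bounds in Hs.
  pose proof asin_inv_ampl_bounds. pose proof ampl_gt1.
  assert (H1 : sin (omega y0 * s) < sin (omega y0 * half_width y0))
    by (rewrite omega_half_width; apply sin_increasing_1; lra).
  assert (H2 : sin (omega y0 * - half_width y0) < sin (omega y0 * s))
    by (replace (omega y0 * - half_width y0) with (- asin (/ ampl y0))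
          by (rewrite <- omega_half_width; ring); apply sin_increasing_1; lra).
  pose proof neg_sin_half_width as D. pose proof (neg_sin_opp (half_width y0)) as D'.
  unfold neg_sin in *. nra.
Qed.

(** Less than a quarter period has elapsed. This makes both terms of [sol_y] positive, so the curve
    stays in the half-plane all the way to its ends. *)
Lemma cos_omega_pos (s : R) :
  - half_width y0 < s < half_width y0 -> 0 < cos (omega y0 * s).
Proof.
  intros Hs. apply omega_mul_bounds in Hs. pose proof asin_inv_ampl_bounds.
  apply cos_gt_0; lra.
Qed.

Lemma sol_cos_pos (s : R) :
  - half_width y0 < s < half_width y0 -> 0 < sol_cos y0 s.
Proof.
  intros Hs. apply neg_sin_bounds in Hs. apply sqrt_lt_R0. nra.
Qed.

Lemma cos_sol_theta (s : R) :
  - half_width y0 < s < half_width y0 ->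
  cos (sol_theta y0 s) = sol_cos y0 s.
Proof.
  intros Hs. apply neg_sin_bounds in Hs. unfold sol_theta.
  rewrite cos_neg, cos_asin by lra. reflexivity.
Qed.

Lemma sin_sol_theta (s : R) :
  - half_width y0 < s < half_width y0 ->
  sin (sol_theta y0 s) = - neg_sin y0 s.
Proof.
  intros Hs. apply neg_sin_bounds in Hs. unfold sol_theta.
  rewrite sin_neg, sin_asin; lra.
Qed.

Lemma is_derive_neg_sin (s : R) :
  is_derive (neg_sin y0) s (ampl y0 * (omega y0 * cos (omega y0 * s))).
Proof. unfold neg_sin. auto_derive; auto. ring. Qed.

Lemma continuous_neg_sin (s : R) : continuous (neg_sin y0) s.
Proof. apply (ex_derive_continuous (neg_sin y0)). eexists. apply is_derive_neg_sin. Qed.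

Lemma continuous_sol_cos (s : R) : continuous (sol_cos y0) s.
Proof.
  apply (continuous_comp (fun s => 1 - neg_sin y0 s * neg_sin y0 s) sqrt).
  - apply (continuous_minus (fun _ : R => 1) (fun s => neg_sin y0 s * neg_sin y0 s)).
    + apply continuous_const.
    + apply (continuous_mult (neg_sin y0) (neg_sin y0)); apply continuous_neg_sin.
  - apply continuous_sqrt.
Qed.

Lemma is_derive_sol_x (s : R) : is_derive (sol_x y0) s (sol_cos y0 s).
Proof.
  apply (is_derive_RInt (sol_cos y0) (sol_x y0) 0).
  - apply filter_forall. intros t. apply (RInt_correct (sol_cos y0)).
    apply (ex_RInt_continuous (sol_cos y0)). intros; apply continuous_sol_cos.
  - apply continuous_sol_cos.
Qed.

Lemma continuous_sol_x (s : R) : continuous (sol_x y0) s.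
Proof. apply (ex_derive_continuous (sol_x y0)). eexists. apply is_derive_sol_x. Qed.

Lemma is_derive_sol_y (s : R) : is_derive (sol_y y0) s (- neg_sin y0 s).
Proof.
  pose proof root_pos. pose proof root_sqr as E. unfold sol_y.
  auto_derive; [lra|]. rewrite <- E. unfold neg_sin, omega, ampl. field. lra.
Qed.

Lemma sol_y_pos (s : R) :
  - half_width y0 < s < half_width y0 -> 0 < sol_y y0 s.
Proof.
  intros Hs. pose proof (cos_omega_pos s Hs). apply Rdiv_lt_0_compat; [|lra].
  assert (0 < y0 * (1 + y0)) by nra. nra.
Qed.

Lemma sol_cos_sqr (s : R) :
  - half_width y0 < s < half_width y0 ->
  sol_cos y0 s * sol_cos y0 s = 1 - neg_sin y0 s * neg_sin y0 s.
Proof.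
  intros Hs. apply neg_sin_bounds in Hs. apply sqrt_sqrt. nra.
Qed.

Lemma is_derive_sol_theta (s : R) :
  - half_width y0 < s < half_width y0 ->
  is_derive (sol_theta y0) s (- (1 / sol_cos y0 s) - sol_cos y0 s / sol_y y0 s).
Proof.
  intros Hs. pose proof (sol_cos_pos s Hs) as Hc. pose proof (sol_y_pos s Hs) as Hy.
  pose proof (sol_cos_sqr s Hs) as E.
  evar_last.
  - apply (is_derive_opp (fun s => asin (neg_sin y0 s))).
    apply (is_derive_comp asin (neg_sin y0)).
    + apply is_derive_asin, neg_sin_bounds, Hs.
    + apply is_derive_neg_sin.
  - change (- (ampl y0 * (omega y0 * cos (omega y0 * s)) * / sol_cos y0 s)
            = - (1 / sol_cos y0 s) - sol_cos y0 s / sol_y y0 s).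
    (* With denominators cleared, the claim reads K omega cos(omega s) y = y + cos^2 theta, an
       identity between polynomials in cos(omega s). *)
    apply (Rmult_eq_reg_r (sol_cos y0 s * sol_y y0 s)); [|nra].
    transitivity (- (ampl y0 * omega y0 * cos (omega y0 * s)) * sol_y y0 s);
      [field; lra|].
    transitivity (- sol_y y0 s - sol_cos y0 s * sol_cos y0 s); [|field; lra].
    rewrite E. unfold sol_y, neg_sin.
    assert (T : sin (omega y0 * s) * sin (omega y0 * s) =
                1 - cos (omega y0 * s) * cos (omega y0 * s))
      by (pose proof (sin2_cos2 (omega y0 * s)); unfold Rsqr in *; lra).
    pose proof root_pos. pose proof root_sqr as R2.
    transitivity (-1 - (y0 * y0 + y0 * (1 + y0) * cos (omega y0 * s)) / (1 + 2 * y0)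
      + ampl y0 * ampl y0 * (sin (omega y0 * s) * sin (omega y0 * s))); [|ring].
    rewrite T.
    (* The square root in [root y0] cancels from K^2 and from K omega, which leaves rational
       functions of [y0]. *)
    replace (ampl y0 * ampl y0) with ((1 + y0) * (1 + y0) / (1 + 2 * y0))
      by (rewrite <- R2; unfold ampl; field; lra).
    replace (ampl y0 * omega y0) with ((1 + y0) / y0)
      by (unfold ampl, omega; field; lra).
    field. lra.
Qed.

Lemma sol_0 : sol_x y0 0 = 0 /\ sol_y y0 0 = y0 /\ neg_sin y0 0 = 0 /\
  sol_theta y0 0 = 0.
Proof.
  assert (D : neg_sin y0 0 = 0) by (unfold neg_sin; rewrite Rmult_0_r, sin_0; ring).
  repeat split; auto.
  - apply (RInt_point 0 (sol_cos y0)).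
  - unfold sol_y. rewrite Rmult_0_r, cos_0. field. lra.
  - unfold sol_theta. rewrite D, asin_0. ring.
Qed.

Lemma sol_is_solution :
  is_solution (- half_width y0) (half_width y0) (sol_x y0) (sol_y y0) (sol_theta y0).
Proof.
  intros s Hs. change (- half_width y0 < s /\ s < half_width y0) in Hs.
  rewrite (cos_sol_theta s Hs), (sin_sol_theta s Hs).
  refine (conj _ (conj _ (conj _ (conj _ _)))).
  - now apply sol_y_pos.
  - pose proof (sol_cos_pos s Hs). lra.
  - apply is_derive_sol_x.
  - apply is_derive_sol_y.
  - now apply is_derive_sol_theta.
Qed.

End ExplicitSolution.

(** * Uniqueness and the maximal interval *)

Section Uniqueness.

Context (y0 : R) (a b : Rbar) (x y theta : R -> R)
  (hy0 : 0 < y0) (hab : Rbar_interval a b 0) (hsol : is_solution a b x y theta)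
  (hx : x 0 = 0) (hy : y 0 = y0) (htheta : theta 0 = 0).

(** A solution never meets cos theta = 0, so by the intermediate value theorem cos theta keeps the
    sign it has at 0. This later selects the positive root of cos^2 theta and makes the slope tan
    theta decrease. *)
Lemma cos_theta_pos (s : R) : Rbar_interval a b s -> 0 < cos (theta s).
Proof.
  intros Hs.
  apply (positive_of_nonzero_Rbar_interval a b (fun s => cos (theta s)) 0 s); auto.
  - intros u Hu. destruct (hsol u Hu) as (_ & Hc & _ & _ & Ht). split; auto.
    apply (continuity_pt_comp theta cos); [|apply continuity_cos].
    eapply is_derive_continuity_pt, Ht.
  - rewrite htheta, cos_0. lra.
Qed.

(** The factor cos theta from the chain rule cancels the singular term 1 / cos theta. *)
Lemma is_derive_sin_theta (s : R) : Rbar_interval a b s ->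
  is_derive (fun s => sin (theta s)) s (-1 - cos (theta s) * cos (theta s) / y s).
Proof.
  intros Hs. destruct (hsol s Hs) as (Hy & Hc & _ & _ & Ht).
  evar_last.
  - apply (is_derive_comp sin theta); [|exact Ht].
    apply is_derive_Reals, derivable_pt_lim_sin.
  - change ((- (1 / cos (theta s)) - cos (theta s) / y s) * cos (theta s)
      = -1 - cos (theta s) * cos (theta s) / y s). field. lra.
Qed.

(** Conservation of the quantity C of the overview between 0 and [s], with denominators cleared. *)
Lemma first_integral (s : R) : Rbar_interval a b s ->
  y0 * y0 * (cos (theta s) * cos (theta s) + 2 * y s) =
  (1 + 2 * y0) * (y s * y s).
Proof.
  intros Hs.
  (* Writing cos^2 as 1 - sin^2 lets the derivative be computed from [is_derive_sin_theta] and y' =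
     sin theta alone. *)
  assert (E : (1 - sin (theta s) * sin (theta s) + 2 * y s) / (y s * y s) =
              (1 - sin (theta 0) * sin (theta 0) + 2 * y 0) / (y 0 * y 0)).
  { apply (null_derivative_Rbar_interval a b (fun s =>
      (1 - sin (theta s) * sin (theta s) + 2 * y s) / (y s * y s)) 0 s); auto.
    intros u Hu. destruct (hsol u Hu) as (Hy & _ & _ & Hdy & _).
    pose proof (is_derive_sin_theta u Hu) as Hds.
    (* Folded into [p], sin theta is an unknown function for [auto_derive]; its derivative is then
       supplied by [Hds]. *)
    set (p := fun s => sin (theta s)) in *.
    apply (is_derive_ext (fun s => (1 - p s * p s + 2 * y s) / (y s * y s)));
      [reflexivity|].
    assert (ex_derive p u) by (eexists; apply Hds).
    assert (ex_derive y u) by (eexists; apply Hdy).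
    auto_derive; [repeat split; auto; nra|].
    replace (Derive (fun x => p x) u) with (-1 - cos (theta u) * cos (theta u) / y u)
      by (symmetry; now apply is_derive_unique).
    replace (Derive (fun x => y x) u) with (p u)
      by (symmetry; now apply is_derive_unique).
    assert (cos (theta u) * cos (theta u) = 1 - p u * p u) as ->
      by (unfold p; pose proof (sin2_cos2 (theta u)); unfold Rsqr in *; lra).
    field. lra. }
  rewrite htheta, sin_0, hy in E. destruct (hsol s Hs) as (Hy & _).
  assert (cos (theta s) * cos (theta s) = 1 - sin (theta s) * sin (theta s)) as ->
    by (pose proof (sin2_cos2 (theta s)); unfold Rsqr in *; lra).
  transitivity ((1 - sin (theta s) * sin (theta s) + 2 * y s) / (y s * y s)
    * (y0 * y0 * (y s * y s))); [field; lra|].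
  rewrite E. field. lra.
Qed.

(* The difference [z] of two solutions of [y'' = 1 - C y] has constant energy
   [z'^2 + C z^2]. *)
Lemma solution_eq_sol_y (s : R) : Rbar_interval a b s ->
  y s = sol_y y0 s /\ sin (theta s) = - neg_sin y0 s.
Proof.
  intros Hs.
  set (C := omega y0 * omega y0).
  assert (HC : C = (1 + 2 * y0) / (y0 * y0))
    by (unfold C, omega; rewrite <- (root_sqr y0 hy0); field; lra).
  assert (C0 : 0 < C) by (pose proof (omega_pos y0 hy0); unfold C; nra).
  set (E := fun s => (sin (theta s) + neg_sin y0 s) * (sin (theta s) + neg_sin y0 s)
    + C * ((y s - sol_y y0 s) * (y s - sol_y y0 s))).
  assert (Es : E s = E 0).
  { apply (null_derivative_Rbar_interval a b); auto. intros u Hu.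
    destruct (hsol u Hu) as (Hy & _ & _ & Hdy & _).
    pose proof (is_derive_sin_theta u Hu) as Hds.
    set (p := fun s => sin (theta s)) in *.
    pose proof (is_derive_neg_sin y0 u) as Hdd.
    pose proof (is_derive_sol_y y0 hy0 u) as Hdsy.
    apply (is_derive_ext (fun s => (p s + neg_sin y0 s) * (p s + neg_sin y0 s)
      + C * ((y s - sol_y y0 s) * (y s - sol_y y0 s)))); [reflexivity|].
    assert (ex_derive p u) by (eexists; apply Hds).
    assert (ex_derive y u) by (eexists; apply Hdy).
    assert (ex_derive (neg_sin y0) u) by (eexists; apply Hdd).
    assert (ex_derive (sol_y y0) u) by (eexists; apply Hdsy).
    auto_derive; [repeat split; auto|].
    replace (Derive (fun x => p x) u) with (-1 - cos (theta u) * cos (theta u) / y u)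
      by (symmetry; now apply is_derive_unique).
    replace (Derive (fun x => y x) u) with (p u)
      by (symmetry; now apply is_derive_unique).
    replace (Derive (fun x => neg_sin y0 x) u)
      with (ampl y0 * (omega y0 * cos (omega y0 * u)))
      by (symmetry; now apply is_derive_unique).
    replace (Derive (fun x => sol_y y0 x) u) with (- neg_sin y0 u)
      by (symmetry; now apply is_derive_unique).
    (* The first integral makes the equation for sin theta linear in [y]. *)
    assert (-1 - cos (theta u) * cos (theta u) / y u = 1 - C * y u) as ->.
    { assert (0 < y0 * y0 * y u) by (apply Rmult_lt_0_compat; nra).
      apply (Rmult_eq_reg_r (y0 * y0 * y u)); [|lra].
      transitivity (y0 * y0 * y u - y0 * y0 * (cos (theta u) * cos (theta u) + 2 * y u));
        [field; lra|].
      rewrite (first_integral u Hu), HC. field. lra. }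
    (* The explicit formulas obey the same linear equation, so the two contributions to the
       derivative of the energy cancel. *)
    assert (ampl y0 * (omega y0 * cos (omega y0 * u)) = - 1 + C * sol_y y0 u) as ->.
    { rewrite HC. pose proof (root_pos y0 hy0).
      (* Only the factor [omega] is unfolded: both cosines keep the same argument and form a single
         atom for [field]. *)
      unfold ampl, omega at 1, sol_y. field. lra. }
    ring. }
  destruct (sol_0 y0 hy0) as (_ & Y0 & D0 & _).
  unfold E in Es. rewrite htheta, sin_0, hy, Y0, D0 in Es.
  set (u := sin (theta s) + neg_sin y0 s) in *. set (v := y s - sol_y y0 s) in *.
  assert (u * u + C * (v * v) = 0) by (rewrite Es; ring).
  assert (0 <= u * u) by apply Rle_0_sqr.
  assert (0 <= v * v) by apply Rle_0_sqr.
  assert (u * u = 0) by nra. assert (v * v = 0) by nra.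
  assert (u = 0) by nra. assert (v = 0) by nra.
  unfold u, v in *. lra.
Qed.

(** The left side is sin^2 theta, and cos theta does not vanish. This is the obstruction to reaching
    the parameters [- half_width y0] and [half_width y0]. *)
Lemma neg_sin_lt1 (s : R) : Rbar_interval a b s -> neg_sin y0 s * neg_sin y0 s < 1.
Proof.
  intros Hs. destruct (solution_eq_sol_y s Hs) as [_ Hd].
  pose proof (cos_theta_pos s Hs). pose proof (sin2_cos2 (theta s)).
  unfold Rsqr in *. rewrite Hd in *. nra.
Qed.

(** An interval going further would contain a parameter at which [neg_sin] is 1 or -1, against
    [neg_sin_lt1]. *)
Lemma half_width_extends :
  Rbar_le (- half_width y0) a /\ Rbar_le b (half_width y0).
Proof.
  pose proof (half_width_pos y0 hy0) as HB.
  pose proof (neg_sin_half_width y0 hy0) as D.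
  destruct hab as [Ha Hb]. split.
  - destruct (Rbar_le_lt_dec (- half_width y0) a) as [|H]; auto. exfalso.
    assert (I : Rbar_interval a b (- half_width y0)).
    { split; auto. apply (Rbar_lt_trans _ 0); auto. simpl. lra. }
    apply neg_sin_lt1 in I. rewrite neg_sin_opp, D in I. lra.
  - destruct (Rbar_le_lt_dec b (half_width y0)) as [|H]; auto. exfalso.
    assert (I : Rbar_interval a b (half_width y0)).
    { split; auto. apply (Rbar_lt_trans _ 0); auto. }
    apply neg_sin_lt1 in I. rewrite D in I. lra.
Qed.

Lemma interval_bounds (s : R) : Rbar_interval a b s ->
  - half_width y0 < s < half_width y0.
Proof.
  destruct half_width_extends as [Ha Hb]. intros [Hs1 Hs2]. split.
  - exact (Rbar_le_lt_trans _ _ _ Ha Hs1).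
  - exact (Rbar_lt_le_trans _ _ _ Hs2 Hb).
Qed.

Lemma cos_theta_eq (s : R) : Rbar_interval a b s -> cos (theta s) = sol_cos y0 s.
Proof.
  intros Hs. destruct (solution_eq_sol_y s Hs) as [_ Hd].
  pose proof (cos_theta_pos s Hs). unfold sol_cos.
  rewrite <- (sqrt_square (cos (theta s))) by lra. f_equal.
  pose proof (sin2_cos2 (theta s)). unfold Rsqr in *. rewrite Hd in *. lra.
Qed.

(** Once [y] and cos theta are identified, the right-hand sides for x' and theta' coincide with the
    explicit ones, so both differences are constant and vanish at 0. *)
Lemma solution_eq_sol (s : R) : Rbar_interval a b s ->
  x s = sol_x y0 s /\ y s = sol_y y0 s /\ theta s = sol_theta y0 s.
Proof.
  intros Hs. destruct (sol_0 y0 hy0) as (X0 & _ & _ & T0).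
  assert (Ex : x s - sol_x y0 s = x 0 - sol_x y0 0).
  { apply (null_derivative_Rbar_interval a b (fun s => x s - sol_x y0 s)); auto.
    intros u Hu. destruct (hsol u Hu) as (_ & _ & Hdx & _).
    evar_last. apply (is_derive_minus x (sol_x y0)); [exact Hdx|apply is_derive_sol_x].
    rewrite cos_theta_eq; auto. apply Rminus_diag. }
  assert (Et : theta s - sol_theta y0 s = theta 0 - sol_theta y0 0).
  { apply (null_derivative_Rbar_interval a b (fun s => theta s - sol_theta y0 s)); auto.
    intros u Hu. destruct (hsol u Hu) as (_ & _ & _ & _ & Hdt).
    evar_last. apply (is_derive_minus theta (sol_theta y0)); [exact Hdt|].
    apply is_derive_sol_theta, interval_bounds; auto.
    rewrite cos_theta_eq, (proj1 (solution_eq_sol_y u Hu)); auto. apply Rminus_diag. }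
  destruct (solution_eq_sol_y s Hs). repeat split; auto; lra.
Qed.

End Uniqueness.

(** By uniqueness the explicit solution extends the given one, so maximality forces the two
    intervals to be equal. *)
Lemma maximal_solution_interval (y0 : R) (a b : Rbar) (x y theta : R -> R) :
  0 < y0 -> Rbar_interval a b 0 -> is_maximal_solution a b x y theta ->
  x 0 = 0 -> y 0 = y0 -> theta 0 = 0 ->
  a = Finite (- half_width y0) /\ b = Finite (half_width y0).
Proof.
  intros hy0 hab [hsol hmax] hx hy ht.
  destruct (half_width_extends y0 a b x y theta hy0 hab hsol hy ht) as [Ha Hb].
  destruct (hmax (- half_width y0) (half_width y0)
    (sol_x y0) (sol_y y0) (sol_theta y0)) as [E1 E2]; auto.
  - now apply sol_is_solution.
  - intros s Hs.
    destruct (solution_eq_sol y0 a b x y theta hy0 hab hsol hx hy ht s Hs)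
      as (-> & -> & ->). auto.
Qed.

(** * Shape of the curve: concavity, graph and end tangents *)

(** The height above the tangent line has derivative cos theta (tan theta - tan theta(s0)). As tan
    theta decreases, this is negative after [s0] and positive before it. *)
Lemma solution_below_tangent (a b : Rbar) (x y theta : R -> R) (s0 s : R) :
  is_solution a b x y theta ->
  (forall u, Rbar_interval a b u -> 0 < cos (theta u)) ->
  Rbar_interval a b s0 -> Rbar_interval a b s ->
  y s <= y s0 + tan (theta s0) * (x s - x s0).
Proof.
  intros Hsol Hcos Hs0 Hs.
  destruct (mean_value_Rbar_interval a b
    (fun u => y u - tan (theta s0) * x u)
    (fun u => sin (theta u) - tan (theta s0) * cos (theta u)) s0 s)
    as [c [Hc [Hcb E]]]; auto.
  { intros u Hu. destruct (Hsol u Hu) as (_ & _ & Hdx & Hdy & _).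
    apply (is_derive_minus y (fun u => tan (theta s0) * x u)); auto.
    apply (is_derive_scal x). exact Hdx. }
  (* Both terms of theta' are negative because cos theta and [y] are positive. *)
  assert (Hmono : forall u v, Rbar_interval a b u -> Rbar_interval a b v ->
    u < v -> tan (theta v) < tan (theta u)).
  { intros u v Hu Hv Huv. apply Ropp_lt_cancel.
    apply (increasing_Rbar_interval a b (fun w => - tan (theta w))
      (fun w => - ((- (1 / cos (theta w)) - cos (theta w) / y w)
         * (tan (theta w) * tan (theta w) + 1))) u v); auto.
    intros w Hw. pose proof (Hcos w Hw) as Hcw.
    destruct (Hsol w Hw) as (Hyw & _ & _ & _ & Hdt). split.
    - apply (is_derive_opp (fun w => tan (theta w))).
      apply (is_derive_comp tan theta); [|exact Hdt].
      evar_last. apply is_derive_tan; lra. simpl; ring.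
    - assert (0 < 1 / cos (theta w)) by (apply Rdiv_lt_0_compat; lra).
      assert (0 < cos (theta w) / y w) by (apply Rdiv_lt_0_compat; lra).
      nra. }
  assert (Ec : sin (theta c) = tan (theta c) * cos (theta c))
    by (pose proof (Hcos c Hc); unfold tan; field; lra).
  rewrite Ec in E. pose proof (Hcos c Hc).
  enough ((tan (theta c) - tan (theta s0)) * (s - s0) <= 0) by nra.
  unfold Rmin, Rmax in Hcb. destruct (Rle_dec s0 s).
  - destruct (Req_dec c s0) as [->|]; [lra|].
    pose proof (Hmono s0 c Hs0 Hc). nra.
  - destruct (Req_dec c s0) as [->|]; [lra|].
    pose proof (Hmono c s0 Hc Hs0). nra.
Qed.

Theorem theorem5p7 (y0 : R) (a b : Rbar) (x y theta : R -> R)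
  (hy0 : 0 < y0)
  (hab : Rbar_interval a b 0)
  (hmax : is_maximal_solution a b x y theta)
  (hx : x 0 = 0) (hy : y 0 = y0) (htheta : theta 0 = 0) :
  exists (xm xM : R) (f : R -> R),
    xm < xM /\
    is_graph_over a b x y xm xM f /\
    concave_on xm xM f /\
    vertical_tangent_limit (within (Rbar_interval a b) (Rbar_locally a)) x y xm /\
    vertical_tangent_limit (within (Rbar_interval a b) (Rbar_locally b)) x y xM.
Proof.
  destruct (maximal_solution_interval y0 a b x y theta) as [Ea Eb]; auto.
  destruct hmax as [hsol _].
  pose proof (cos_theta_pos a b x y theta hab hsol htheta) as Hcos.
  pose proof (solution_eq_sol y0 a b x y theta hy0 hab hsol hx hy htheta) as Hxyt.
  pose proof (solution_eq_sol_y y0 a b x y theta hy0 hab hsol hy htheta) as Hsin.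
  pose proof (cos_theta_eq y0 a b x y theta hy0 hab hsol hy htheta) as Hcos'.
  set (B := half_width y0) in *.
  assert (HI : forall s, Rbar_interval a b s <-> - B < s < B)
    by (intros s; rewrite Ea, Eb; reflexivity).
  assert (HB : 0 < B) by apply (half_width_pos y0 hy0).
  assert (HD : neg_sin y0 B = 1) by apply (neg_sin_half_width y0 hy0).
  (* The ends are included: [sol_x] is differentiable on the whole line, and its values at [- B] and
     [B] will be [xm] and [xM]. *)
  assert (Hmono : forall s t, - B <= s -> t <= B -> s < t -> sol_x y0 s < sol_x y0 t).
  { intros s t Hs Ht Hst.
    destruct (MVT_cor2 (sol_x y0) (sol_cos y0) s t Hst) as [c [E Hc]].
    - intros c _. apply is_derive_Reals, is_derive_sol_x.
    - assert (0 < sol_cos y0 c) by (apply sol_cos_pos; unfold B in *; auto; lra).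
      nra. }
  assert (Hinv : forall p, sol_x y0 (- B) < p < sol_x y0 B ->
    exists s, Rbar_interval a b s /\ x s = p).
  { intros p Hp.
    destruct (IVT_gen (sol_x y0) (- B) B p) as [s [Hs Es]].
    - intros s. eapply is_derive_continuity_pt, is_derive_sol_x.
    - unfold Rmin, Rmax. destruct (Rle_dec _ _); lra.
    - rewrite Rmin_left, Rmax_right in Hs by lra.
      assert (s <> B) by (intros ->; lra).
      assert (s <> - B) by (intros ->; lra).
      assert (Is : Rbar_interval a b s) by (apply HI; lra).
      exists s. split; auto. rewrite (proj1 (Hxyt s Is)). exact Es. }
  (* An inverse of [x], obtained by choice from the existence in [Hinv]; its value is unspecified
     outside the open interval of abscissas. *)
  set (sigma := fun p => epsilon (inhabits 0) (fun s => Rbar_interval a b s /\ x s = p)).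
  assert (Hsigma : forall p, sol_x y0 (- B) < p < sol_x y0 B ->
    Rbar_interval a b (sigma p) /\ x (sigma p) = p)
    by (intros p Hp; apply (epsilon_spec (inhabits 0)), Hinv, Hp).
  (* One argument serves both ends: the limits of x, x', y' are the values of [sol_x], [sol_cos],
     [- neg_sin] at [e], and the hypothesis makes the second zero and the third nonzero. *)
  assert (Hvert : forall e : R, neg_sin y0 e * neg_sin y0 e = 1 ->
    vertical_tangent_limit (within (Rbar_interval a b) (Rbar_locally e)) x y
      (sol_x y0 e)).
  { intros e He. split; [|exists (- neg_sin y0 e); split; [nra|split]].
    - apply filterlim_within_continuous; [|apply continuous_sol_x].
      intros s Is. symmetry. apply Hxyt, Is.
    - replace 0 with (sol_cos y0 e)
        by (unfold sol_cos; rewrite He, Rminus_diag; apply sqrt_0).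
      apply filterlim_within_continuous; [|apply continuous_sol_cos].
      intros s Is. rewrite <- (Hcos' s Is). symmetry.
      apply is_derive_unique, (hsol s Is).
    - apply (filterlim_within_continuous _ _ (fun s => - neg_sin y0 s)).
      + intros s Is. rewrite <- (proj2 (Hsin s Is)). symmetry.
        apply is_derive_unique, (hsol s Is).
      + apply (continuous_opp (neg_sin y0)), continuous_neg_sin. }
  exists (sol_x y0 (- B)), (sol_x y0 B), (fun p => y (sigma p)).
  split; [apply Hmono; lra|]. split; [|split; [|split]].
  - intros p q. split.
    + intros (s & Is & Ex & Ey). pose proof (proj1 (HI s) Is).
      pose proof (proj1 (Hxyt s Is)) as Exs.
      assert (Hp : sol_x y0 (- B) < p < sol_x y0 B)
        by (rewrite <- Ex, Exs; split; apply Hmono; lra).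
      split; auto. rewrite <- Ey. f_equal.
      destruct (Hsigma p Hp) as [It Et]. pose proof (proj1 (HI _) It).
      rewrite (proj1 (Hxyt _ It)) in Et.
      destruct (Rtotal_order s (sigma p)) as [L|[L|L]]; auto; exfalso.
      * apply Hmono in L; lra.
      * apply Hmono in L; lra.
    + intros [Hp ->]. exists (sigma p). destruct (Hsigma p Hp). auto.
  - intros p q t Hp Hq Ht.
    assert (Hm : sol_x y0 (- B) < t * p + (1 - t) * q < sol_x y0 B).
    { clear - Hp Hq Ht. destruct (Rle_lt_dec p q).
      - assert (p <= t * p + (1 - t) * q <= q) by nra. lra.
      - assert (q <= t * p + (1 - t) * q <= p) by nra. lra. }
    destruct (Hsigma _ Hp) as [Ip Ep]. destruct (Hsigma _ Hq) as [Iq Eq].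
    destruct (Hsigma _ Hm) as [Im Em].
    (* Both points of the graph lie below the tangent at the intermediate point; that tangent is
       affine, so averaging its two heights gives back the height [y m]. *)
    pose proof (solution_below_tangent a b x y theta _ _ hsol Hcos Im Ip) as Tp.
    pose proof (solution_below_tangent a b x y theta _ _ hsol Hcos Im Iq) as Tq.
    rewrite Ep, Em in Tp. rewrite Eq, Em in Tq.
    set (T := tan _) in *. set (m := sigma (t * p + (1 - t) * q)) in *.
    replace (y m) with (t * (y m + T * (p - (t * p + (1 - t) * q))) +
      (1 - t) * (y m + T * (q - (t * p + (1 - t) * q)))) by ring.
    apply Rplus_le_compat; apply Rmult_le_compat_l; lra.
  (* Only the point approached by the filter is rewritten; the domain keeps [a], as in [Hvert]. *)
  - rewrite Ea at 2. apply Hvert. rewrite neg_sin_opp, HD. ring.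
  - rewrite Eb at 2. apply Hvert. rewrite HD. ring.
Qed.
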